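(* Let $\tau$ be an operational type. The Boolean-topological algebras of type $\tau$ are, up to isomorphism of topological algebras, precisely the extended Stone duals of Boolean residuation algebras of type $\tau$ for which residuation is join preserving at primes. That is: (i) if $B$ is a Boolean residuation algebra of type $\tau$ for which residuation is join preserving at primes, then the extended Stone dual $X_B$ of $B$ (the Stone space of $B$ equipped, for each operation symbol, with the induced operation on points) is a Boolean-topological algebra of type $\tau$; and (ii) every Boolean-topological algebra of type $\tau$ is isomorphic, as a topological algebra, to the extended Stone dual of some Boolean residuation algebra of type $\tau$ for which residuation is join preserving at primes.
   Context: All operation symbols $f$ of $\tau$ have some finite arity $n\geq 1$. A Boolean space is a compact Hausdorff space with a basis of clopen sets. A Boolean-topological algebra of type $\tau$ is a Boolean space equipped with an algebra structure of type $\tau$ all of whose basic operations are continuous (product topology on the domain); isomorphisms are algebra isomorphisms that are homeomorphisms. A residuation algebra of type $\tau$ is a bounded distributive lattice $D$ with, for each $n$-ary $f\in\tau$ and each $1\leq i\leq n$, an operation $f_i^{\sharp}:D^n\to D$, written $f_i^{\sharp}(a_1,\ldots,a_{i-1},a_{i+1},\ldots,a_n,c)$, such that: each $f_i^\sharp$ preserves finite meets (including the empty one) in its last coordinate $c$; and for all $i,j$ and all $a_1,\ldots,a_n,c\in D$, $$a_i\leq f_i^{\sharp}(a_1,\ldots,a_{i-1},a_{i+1},\ldots,a_n,c)\iff a_j\leq f_j^{\sharp}(a_1,\ldots,a_{j-1},a_{j+1},\ldots,a_n,c).$$ (In the binary case one writes $a\backslash c$ for $f_2^\sharp(a,c)$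 and $c/b$ for $f_1^\sharp(b,c)$, so $b\leq a\backslash c\iff a\leq c/b$.) It is a Boolean residuation algebra if the lattice $D$ is Boolean. For each $n$-ary $f\in\tau$ and filters $F_1,\ldots,F_n$ of $D$ put $$f(F_1,\ldots,F_n)=\{c\in D\mid \exists a_j\in F_j\ (1\le j\le n-1)\text{ with } f_n^\sharp(a_1,\ldots,a_{n-1},c)\in F_n\},$$ which is a filter of $D$ (in the binary case, $F\cdot G=\{c\mid\exists a\in F,\ a\backslash c\in G\}$). Residuation is join preserving at primes if, for every $f\in\tau$, this operation on filters sends tuples of prime filters (prime filters being proper) to prime filters. For a Boolean algebra $B$, the Stone space $X_B$ has as points $x$ the prime filters $F_x$ of $B$, with topology generated by the sets $\eta_B(a)=\{x\mid a\in F_x\}$, $a\in B$. When residuation is join preserving at primes, the extended Stone dual of $B$ is $X_B$ with the operations $f$ given by $F_{f(x_1,\ldots,x_n)}=f(F_{x_1},\ldots,F_{x_n})$. *)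

(* Defs.v *)
From HB Require Import structures.
From mathcomp Require Import all_boot all_order.
From mathcomp Require Import boolp classical_sets functions filter topology.

Set Implicit Arguments.
Unset Strict Implicit.
Unset Printing Implicit Defensive.

Local Open Scope classical_set_scope.

(* Operation symbols have arity at least 1; this is built in by recording
   the predecessor of the arity. *)
Record signature := Signature {
  op_symbol :> Type;
  pred_arity : op_symbol -> nat
}.

Definition arity (tau : signature) (f : tau) : nat := (pred_arity f).+1.

Definition algebra_ops (tau : signature) (A : Type) :=
  forall f : tau, ('I_(arity f) -> A) -> A.

Definition boolean_space (X : topologicalType) :=
  [/\ compact [set: X], hausdorff_space X &
      exists2 U : set (set X), basis U & U `<=` clopen].

(* The domain of each operation carries the product topology, which is the
   topology of the type {ptws _ -> _}. *)
Definition boolean_topological_algebra (tau : signature) (X : topologicalType)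
    (op : algebra_ops tau X) :=
  boolean_space X /\
  forall f : tau, continuous (op f : {ptws 'I_(arity f) -> X} -> X).

Definition topological_algebra_iso (tau : signature) (X Y : topologicalType)
    (opX : algebra_ops tau X) (opY : algebra_ops tau Y) :=
  exists (phi : X -> Y) (psi : Y -> X),
    [/\ cancel phi psi, cancel psi phi, continuous phi, continuous psi &
        forall (f : tau) (x : 'I_(arity f) -> X),
          phi (opX f x) = opY f (phi \o x)].

(* [R f i b c] is f_i^#(a_1, .., a_{i-1}, a_{i+1}, .., a_n, c), where
   [b k = a (lift i k)] lists the a_j with j != i in increasing order. *)
Definition residuation_ops (tau : signature) (D : Type) :=
  forall f : tau, 'I_(arity f) -> ('I_(pred_arity f) -> D) -> D -> D.

Record residuation_algebra (tau : signature) (d : Order.disp_t)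
    (D : tbDistrLatticeType d) (R : residuation_ops tau D) : Prop := {
  residuation_top : forall (f : tau) i b, R f i b \top%O = \top%O;
  residuation_meet : forall (f : tau) i b c c',
    R f i b (c `&` c')%O = (R f i b c `&` R f i b c')%O;
  residuation_adj : forall (f : tau) (i j : 'I_(arity f))
      (a : 'I_(arity f) -> D) (c : D),
    (a i <= R f i (fun k => a (lift i k)) c)%O <->
    (a j <= R f j (fun k => a (lift j k)) c)%O
}.

Section PrimeFilters.
Variables (d : Order.disp_t) (D : tbDistrLatticeType d).

Definition lattice_filter (F : set D) :=
  [/\ F \top%O,
      forall a b, (a <= b)%O -> F a -> F b &
      forall a b, F a -> F b -> F (a `&` b)%O].

Definition prime_filter (F : set D) :=
  [/\ lattice_filter F,
      ~ F \bot%O &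
      forall a b, F (a `|` b)%O -> F a \/ F b].

Definition filter_op (tau : signature) (R : residuation_ops tau D) (f : tau)
    (F : 'I_(arity f) -> set D) : set D :=
  [set c | exists a : 'I_(pred_arity f) -> D,
     (forall j, F (lift ord_max j) (a j)) /\ F ord_max (R f ord_max a c)].

Definition join_preserving_at_primes (tau : signature)
    (R : residuation_ops tau D) :=
  forall (f : tau) (F : 'I_(arity f) -> set D),
    (forall i, prime_filter (F i)) -> prime_filter (filter_op R F).

End PrimeFilters.

Section StoneDual.
Variables (d : Order.disp_t) (B : ctbDistrLatticeType d).

Record stone_space := StonePoint {
  stone_filter : set B;
  stone_filter_prime : prime_filter stone_filter
}.

Definition stone_eta (a : B) : set stone_space := [set x | stone_filter x a].

HB.instance Definition _ := gen_eqMixin stone_space.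
HB.instance Definition _ := gen_choiceMixin stone_space.
HB.instance Definition _ :=
  @isSubBaseTopological.Build stone_space (set stone_space) (range stone_eta) id.

Definition stone_op (tau : signature) (R : residuation_ops tau B)
    (jpR : join_preserving_at_primes R) : algebra_ops tau stone_space :=
  fun f x => StonePoint (jpR f _ (fun i => stone_filter_prime (x i))).

End StoneDual.

(* Main.v *)
Require Import Defs.
From HB Require Import structures.
From mathcomp Require Import all_boot all_order finmap.
From mathcomp Require Import boolp classical_sets functions filter topology.

(** For a Boolean algebra B the sets [stone_eta a] form a basis of clopen sets
    of the Stone space.  An ultrafilter U on the space converges to the point
    given by the prime filter of all a with [stone_eta a] in U, so the space is
    compact; two points with distinct prime filters are separated by some
    [stone_eta a] and its complement.  The lifted operations are continuous
    because the value of f at (x_1, .., x_n) lies in [stone_eta c] exactly when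
    there are a_j in F_{x_j} (j < n) with f_n^#(a, c) in F_{x_n}: this writes
    the preimage of [stone_eta c] as a union of boxes of sets [stone_eta _].

    Conversely, let X be a Boolean-topological algebra and let B be its clopen
    sets.  The residual f_i^#(b, c) is the largest set of values of x_i for
    which x_j in b_j for all j <> i forces f(x) in c.  Its complement is the
    i-th projection of the clopen set of those x with x_j in b_j and f(x)
    outside c.  Projections are open maps, and they are closed because X^n is
    compact and X is Hausdorff, so the residual is clopen.  Both sides of the
    adjunction a_i <= f_i^#(a, c) then say that f maps the box of the a_k
    into c, which does not depend on i ([clopen_residual_leP]).

    By compactness every prime filter of clopen sets consists of all clopen
    neighbourhoods of one point ([prime_filter_point]).  On such filters the
    operation induced by the residuals is f itself
    ([filter_op_point_filter]): if f(x) is in c then by continuity f maps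
    some box of clopen sets around x into c, and the sides of that box witness
    that c belongs to the filter.  Hence the induced operation preserves
    primality, and sending a point to its filter of clopen neighbourhoods is
    the required isomorphism. *)

Set Implicit Arguments.
Unset Strict Implicit.
Unset Printing Implicit Defensive.

Import Order.Theory.
Local Open Scope classical_set_scope.

(** * Finite powers of a space *)

Section FinitePowers.
Context {I : finType} {X : topologicalType}.

(** Boxes are a neighbourhood basis because the filter they generate converges
    in every coordinate; conversely a box is a finite intersection of preimages
    under the projections. *)
Lemma nbhs_ptws_box (x : {ptws I -> X}) (W : set {ptws I -> X}) :
  nbhs x W <->
  exists2 V : I -> set X, (forall i, nbhs (x i) (V i)) &
    forall y : {ptws I -> X}, (forall i, V i (y i)) -> W y.
Proof.
split=> [xW|[V xV VW]].
  pose D := [set V : I -> set X | forall i, nbhs (x i) (V i)].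
  pose box (V : I -> set X) : set {ptws I -> X} :=
    [set y | forall i, V i (y i)].
  have Dbox : Filter (filter_from D box).
    apply: filter_from_filter.
      by exists (fun=> setT) => i; exact: filterT.
    move=> V V' xV xV'; exists (fun i => V i `&` V' i).
      by move=> i; exact: filterI.
    by move=> y yVV'; split=> i; have [] := yVV' i.
  suff : filter_from D box --> x by apply.
  apply/cvg_sup => i U [_ [[W' oW' <-] W'x] sW'U].
  (* A condition on the i-th coordinate alone is a box that is full in the
     other coordinates. *)
  exists (fun j => if j == i then W' else setT).
    move=> j; case: eqP => [->|_]; last exact: filterT.
    exact: open_nbhs_nbhs.
  by move=> y /(_ i); rewrite eqxx => W'y; exact: sW'U.
apply: (@filterS {ptws I -> X} _ (nbhs_filter x)
  [set y : {ptws I -> X} | forall i, V i (y i)]) => //.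
apply: (@filter_forall {ptws I -> X} I (fun i y => V i (y i)) _
  (nbhs_filter x)) => i.
exact: (@proj_continuous I (fun=> X) i x _ (xV i)).
Qed.

Lemma clopen_cylinder {J : finType} (h : J -> I) (V : J -> set X) :
  (forall j, clopen (V j)) ->
  clopen [set y : {ptws I -> X} | forall j, V j (y (h j))].
Proof.
move=> Vclopen.
have proj_h j : continuous (fun y : {ptws I -> X} => y (h j) : X).
  exact: (@proj_continuous I (fun=> X) (h j)).
split.
  rewrite openE => y yV.
  apply: (@filter_forall {ptws I -> X} J (fun j y => V j (y (h j))) _
    (nbhs_filter y)) => j.
  by apply: proj_h; apply: open_nbhs_nbhs; split; [exact: (Vclopen j).1|].
rewrite (_ : [set _ | _] =
    \bigcap_(j in [set: J]) [set y : {ptws I -> X} | V j (y (h j))]).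
  apply: closed_bigI => j _.
  exact: (preimage_clopen (Vclopen j) (proj_h j)).2.
by apply/seteqP; split=> y yV j *; exact: yV.
Qed.

(** Openness of the image holds for every product; closedness comes from
    compactness of the finite power. *)
Lemma clopen_projection (i : I) (E : set {ptws I -> X}) :
  compact [set: X] -> hausdorff_space X -> clopen E ->
  clopen [set x i | x in E].
Proof.
move=> cX hX [oE cE]; split.
  exact: (@proj_open I (fun=> X) i E oE).
apply: (compact_closed hX).
apply: (@continuous_compact {ptws I -> X} X (fun x => x i)).
  by apply: continuous_subspaceT; exact: (@proj_continuous I (fun=> X) i).
have cP := @tychonoff I (fun=> X) (fun=> setT) (fun=> cX).
exact: (@subclosed_compact {ptws I -> X} E _ cE cP).
Qed.

End FinitePowers.

(** * Stone spaces *)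

Section StoneSpace.
Context {d : Order.disp_t} {B : ctbDistrLatticeType d}.
Implicit Types (x y : stone_space B) (a b : B).

Lemma prime_filter_compl (F : set B) a :
  prime_filter F -> F (~` a)%O <-> ~ F a.
Proof.
move=> [[Ftop _ Fmeet] Fbot Fjoin]; split=> [Fna Fa|Fa].
  by apply: Fbot; rewrite -(meetxC a); exact: Fmeet.
by have [] := Fjoin a (~` a)%O; rewrite ?joinxC.
Qed.

(** Prime filters of a Boolean algebra are maximal, so an inclusion between
    them is an equality. *)
Lemma stone_point_ext x y : stone_filter x `<=` stone_filter y -> x = y.
Proof.
move=> xy; have {xy}: stone_filter x = stone_filter y.
  apply/seteqP; split=> // a ya; apply: contrapT.
  move=> /(prime_filter_compl _ (stone_filter_prime x)) /xy.
  by move=> /(prime_filter_compl _ (stone_filter_prime y)).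
case: x y => [F Fp] [G Gp] /= FG; case: _ / FG Gp => Gp.
by congr StonePoint; exact: Prop_irrelevance.
Qed.

Lemma open_stone_eta a : open (stone_eta a).
Proof.
exists [set stone_eta a]; last exact: bigcup_set1.
move=> _ ->; exists [fset stone_eta a]%fset.
  by move=> U /fset1P ->; apply/mem_set; exact: imageP.
apply/seteqP; split=> x; first by move/(_ (stone_eta a)); apply; exact: fset11.
by move=> xa U /fset1P ->.
Qed.

Lemma stone_etaC a : stone_eta (~` a)%O = ~` stone_eta a.
Proof.
by apply/seteqP; split=> x /(prime_filter_compl _ (stone_filter_prime x)).
Qed.

Lemma clopen_stone_eta a : clopen (stone_eta a).
Proof.
split; first exact: open_stone_eta.
by rewrite -openC -stone_etaC; exact: open_stone_eta.
Qed.

(** The sets [stone_eta a], introduced only as a subbase, are a basis: prime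
    filters are closed under finite meets, so a finite intersection of such
    sets around x contains [stone_eta] of the meet. *)
Lemma nbhs_stone_eta x (U : set (stone_space B)) :
  nbhs x U -> exists2 a, stone_filter x a & stone_eta a `<=` U.
Proof.
rewrite nbhsE => -[_ [[D sD <-] [V DV Vx]] DU].
suff [a xa aV] : exists2 a, stone_filter x a & stone_eta a `<=` V.
  by exists a => // y /aV Vy; apply: DU; exists V.
have [S sS VE] := sD _ DV.
have {}sS W : W \in enum_fset S ->
    exists2 a, stone_filter x a & W = stone_eta a.
  move=> WS; have /set_mem[a _ aW] := sS _ WS; exists a => //.
  by move: Vx; rewrite -VE => /(_ W WS); rewrite -aW.
suff [a xa aV] : exists2 a, stone_filter x a &
    forall W, W \in enum_fset S -> stone_eta a `<=` W.
  by exists a => // y ya; rewrite -VE => W WS; exact: (aV W WS).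
elim: (enum_fset S) sS => [_|W s IHs sS].
  by exists \top%O => //; case: (stone_filter_prime x) => -[].
have [b xb bs] : exists2 b, stone_filter x b &
    forall W, W \in s -> stone_eta b `<=` W.
  by apply: IHs => W' W's; apply: sS; rewrite in_cons W's orbT.
have [a xa WE] := sS W (mem_head _ _).
have [[_ _ Fmeet] _ _] := stone_filter_prime x.
exists (a `&` b)%O; first exact: Fmeet.
move=> W' + y yab; have [[_ Fle _] _ _] := stone_filter_prime y.
rewrite in_cons => /orP[/eqP ->|W's].
  by rewrite WE; apply: Fle yab; exact: leIl.
by apply: (bs W' W's); apply: Fle yab; exact: leIr.
Qed.

Lemma basis_stone_eta : basis (range (@stone_eta d B)).
Proof.
split; first by move=> _ [a _ <-]; exact: open_stone_eta.
move=> x U /nbhs_stone_eta[a xa aU].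
by exists (stone_eta a) => //; split=> //; exists a.
Qed.

Lemma hausdorff_stone_space : hausdorff_space (stone_space B).
Proof.
move=> x y xy; apply: stone_point_ext => a xa; apply: contrapT.
move=> /(prime_filter_compl _ (stone_filter_prime y)) ya.
have [] := xy (stone_eta a) (stone_eta (~` a)%O).
- by apply: open_nbhs_nbhs; split; [exact: open_stone_eta|].
- by apply: open_nbhs_nbhs; split; [exact: open_stone_eta|].
by rewrite stone_etaC => z [].
Qed.

(** An ultrafilter U on the Stone space converges to the prime filter of all a
    with [stone_eta a] in U; U decides each [stone_eta a], hence primality. *)
Lemma compact_stone_space : compact [set: stone_space B].
Proof.
rewrite compact_ultra => U UU _.
have Uprime : prime_filter [set a : B | U (stone_eta a)].
  split; [split=> /= [|a b ab|a b Ua Ub]|move=> /= U0|move=> a b /= Uab].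
  - by apply: filterS filterT => x _; case: (stone_filter_prime x) => -[].
  - apply: filterS => x.
    by have [[_ Fle _] _ _] := stone_filter_prime x; exact: Fle.
  - apply: filterS (filterI Ua Ub) => x [].
    by have [[_ _ Fmeet] _ _] := stone_filter_prime x; exact: Fmeet.
  - by have [x] := filter_ex U0; case: (stone_filter_prime x).
  have [Ua|Una] := in_ultra_setVsetC (stone_eta a) UU; first by left.
  right; apply: filterS (filterI Uab Una) => x [xab xna].
  by have [_ _ Fjoin] := stone_filter_prime x; have [] := Fjoin a b xab.
exists (StonePoint Uprime); split=> // V /nbhs_stone_eta[a Ua aV].
exact: filterS aV Ua.
Qed.

Lemma boolean_stone_space : boolean_space (stone_space B).
Proof.
split; [exact: compact_stone_space|exact: hausdorff_stone_space|].
exists (range (@stone_eta d B)); first exact: basis_stone_eta.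
by move=> _ [a _ <-]; exact: clopen_stone_eta.
Qed.

(** Membership of c in the value filter is witnessed by elements of the argument
    filters; the corresponding basic open sets are the sides of a box around the
    arguments on which the same witnesses work. *)
Lemma stone_op_continuous (tau : signature) (R : residuation_ops tau B)
    (jpR : join_preserving_at_primes R) (f : tau) :
  continuous (stone_op jpR (f := f) :
    {ptws 'I_(arity f) -> stone_space B} -> stone_space B).
Proof.
move=> x U /nbhs_stone_eta[c [a [xa xc]] cU].
apply/nbhs_ptws_box.
exists (fun i => if unlift ord_max i is Some j then stone_eta (a j)
                 else stone_eta (R f ord_max a c)).
  move=> i; apply: open_nbhs_nbhs.
  case: (unliftP ord_max i) => [j ->|->].
    by split; [exact: open_stone_eta|exact: xa].
  by split; [exact: open_stone_eta|exact: xc].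
move=> y ya; apply: cU; exists a; split=> [j|].
  by have := ya (lift ord_max j); rewrite liftK.
by have := ya ord_max; rewrite unlift_none.
Qed.

End StoneSpace.

(** * The Boolean algebra of clopen sets *)

Record clopen_algebra (X : topologicalType) := ClopenSet {
  clopen_set :> set X;
  clopen_setP : clopen clopen_set
}.

Section ClopenAlgebra.
Context {X : topologicalType}.
Implicit Types U V W : clopen_algebra X.

Lemma clopen_ext U V : (U : set X) = V -> U = V.
Proof.
case: U V => [U Uc] [V Vc] /= UV; case: _ / UV Vc => Vc.
by congr ClopenSet; exact: Prop_irrelevance.
Qed.

HB.instance Definition _ := gen_eqMixin (clopen_algebra X).
HB.instance Definition _ := gen_choiceMixin (clopen_algebra X).

Definition clopen_meet U V :=
  ClopenSet (clopenI (clopen_setP U) (clopen_setP V)).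
Definition clopen_join U V :=
  ClopenSet (clopenU (clopen_setP U) (clopen_setP V)).
Definition clopen_bot := ClopenSet (@clopen0 X).
Definition clopen_top := ClopenSet (@clopenT X).
Definition clopen_compl U := ClopenSet (clopenC setT (clopen_setP U)).
Definition clopen_le U V := `[< U `<=` V >].
Definition clopen_lt U V := (V != U) && clopen_le U V.

Fact clopen_leE U V : clopen_le U V = (clopen_meet U V == U).
Proof.
apply/asboolP/eqP => [UV|<-]; last exact: subIsetr.
by apply: clopen_ext; exact/setIidPl.
Qed.
Fact clopen_ltE U V : clopen_lt U V = (V != U) && clopen_le U V.
Proof. by []. Qed.
Fact clopen_meetC : commutative clopen_meet.
Proof. by move=> U V; apply: clopen_ext; exact: setIC. Qed.
Fact clopen_joinC : commutative clopen_join.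
Proof. by move=> U V; apply: clopen_ext; exact: setUC. Qed.
Fact clopen_meetA : associative clopen_meet.
Proof. by move=> U V W; apply: clopen_ext; exact: setIA. Qed.
Fact clopen_joinA : associative clopen_join.
Proof. by move=> U V W; apply: clopen_ext; exact: setUA. Qed.
Fact clopen_joinKI V U : clopen_meet U (clopen_join U V) = U.
Proof. by apply: clopen_ext; rewrite /= setUC setKU. Qed.
Fact clopen_meetKU V U : clopen_join U (clopen_meet U V) = U.
Proof. by apply: clopen_ext; rewrite /= setIC setKI. Qed.
Fact clopen_meetUl : left_distributive clopen_meet clopen_join.
Proof. by move=> U V W; apply: clopen_ext; exact: setIUl. Qed.
Fact clopen_meetxx : idempotent_op clopen_meet.
Proof. by move=> U; apply: clopen_ext; exact: setIid. Qed.

Fact clopen_display : Order.disp_t. Proof. exact: Order.Disp tt tt. Qed.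

HB.instance Definition _ := Order.isMeetJoinDistrLattice.Build clopen_display
  (clopen_algebra X) clopen_leE clopen_ltE clopen_meetC clopen_joinC
  clopen_meetA clopen_joinA clopen_joinKI clopen_meetKU clopen_meetUl
  clopen_meetxx.

Fact clopen_le0x U : (clopen_bot <= U)%O.
Proof. by apply/asboolP; exact: sub0set. Qed.
Fact clopen_lex1 U : (U <= clopen_top)%O.
Proof. exact/asboolP. Qed.

HB.instance Definition _ :=
  Order.hasBottom.Build clopen_display (clopen_algebra X) clopen_le0x.
HB.instance Definition _ :=
  Order.hasTop.Build clopen_display (clopen_algebra X) clopen_lex1.

Fact clopen_joinxC U : (U `|` clopen_compl U)%O = \top%O.
Proof. by apply: clopen_ext; exact: setUCr. Qed.
Fact clopen_meetxC U : (U `&` clopen_compl U)%O = \bot%O.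
Proof. by apply: clopen_ext; exact: setICr. Qed.

HB.instance Definition _ := Order.TBDistrLattice_hasComplement.Build
  clopen_display (clopen_algebra X) clopen_joinxC clopen_meetxC.

Definition point_filter (x : X) : set (clopen_algebra X) :=
  [set U : clopen_algebra X | clopen_set U x].

Lemma point_filter_prime x : prime_filter (point_filter x).
Proof.
by split=> //; split=> // U V /asboolP UV; exact: UV.
Qed.

(** A prime filter F of clopen sets has the finite intersection property, so it
    has a cluster point x; its members are closed, hence contain x.  Maximality
    of F gives the other inclusion. *)
Lemma prime_filter_point (F : set (clopen_algebra X)) :
  compact [set: X] -> prime_filter F -> exists x, F = point_filter x.
Proof.
move=> cX Fprime; have [[Ftop Fle Fmeet] Fbot _] := Fprime.
have GP : ProperFilter (filter_from F (@clopen_set X)).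
  apply: filter_from_proper.
    apply: filter_from_filter; first by exists \top%O.
    by move=> U V FU FV; exists (U `&` V)%O => //; exact: Fmeet.
  move=> U FU; apply/set0P; apply/eqP => U0; apply: Fbot.
  by rewrite (_ : \bot%O = U) //; exact: clopen_ext.
have [x [_ Gx]] := cX _ GP (filterT : filter_from F (@clopen_set X) setT).
have Fx U : F U -> clopen_set U x.
  move=> FU; apply: (clopen_setP U).2.
  by move: Gx; rewrite clusterE; apply; exists U.
exists x; apply/seteqP; split=> // U Ux; apply: contrapT => FU.
by have /Fx := (prime_filter_compl U Fprime).2 FU.
Qed.

End ClopenAlgebra.

(** * Boolean-topological algebras *)

Lemma clopen_nbhs (X : topologicalType) (x : X) (U : set X) :
  boolean_space X -> nbhs x U ->
  exists2 V : clopen_algebra X, clopen_set V x & V `<=` U.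
Proof.
move=> [_ _ [C [_ Cbasis] Cclopen]] /Cbasis[V [CV Vx] VU].
by exists (ClopenSet (Cclopen _ CV)).
Qed.

Section Residuals.
Context {tau : signature} {X : topologicalType} {op : algebra_ops tau X}.
Arguments op : clear implicits.
Hypothesis opP : boolean_topological_algebra op.

(** The obstruction to membership in the residual: the argument tuples that
    satisfy the side conditions [b] off coordinate [i] but are sent outside
    [c]. *)
Definition escape_set (f : tau) (i : 'I_(arity f))
    (b : 'I_(pred_arity f) -> clopen_algebra X) (c : clopen_algebra X) :
    set {ptws 'I_(arity f) -> X} :=
  (op f @^-1` ~` c) `&` [set x | forall k, clopen_set (b k) (x (lift i k))].

Lemma clopen_escape_projection f i b c :
  clopen [set x i | x in @escape_set f i b c].
Proof.
have [[cX hX _] op_cont] := opP.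
apply: (clopen_projection i cX hX).
apply: clopenI.
  apply: (@preimage_clopen {ptws 'I_(arity f) -> X} X (op f)) (op_cont f).
  exact: clopenC setT (clopen_setP c).
by apply: (clopen_cylinder (lift i) (V := b)) => k; exact: clopen_setP.
Qed.

Definition clopen_residual : residuation_ops tau (clopen_algebra X) :=
  fun f i b c => ClopenSet (clopenC setT (@clopen_escape_projection f i b c)).

Arguments clopen_residual : clear implicits.

Lemma clopen_residualP f i b c z :
  clopen_set (clopen_residual f i b c) z <->
  forall x, x i = z -> (forall k, clopen_set (b k) (x (lift i k))) ->
    clopen_set c (op f x).
Proof.
split=> [Rz x xi bx|Rz [x [ncx bx] xi]]; last by apply: ncx; exact: Rz.
by apply: contrapT => ncx; apply: Rz; exists x.
Qed.

Lemma clopen_residual_leP f i (a : 'I_(arity f) -> clopen_algebra X) c :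
  (a i <= clopen_residual f i (fun k => a (lift i k)) c)%O <->
  forall x, (forall k, clopen_set (a k) (x k)) -> clopen_set c (op f x).
Proof.
split=> [/asboolP aR x ax|ac].
  by have /clopen_residualP := aR _ (ax i); apply.
apply/asboolP => z az; apply/clopen_residualP => x xi ax; apply: ac => k.
by case: (unliftP i k) => [j ->|->]; [exact: ax|rewrite xi].
Qed.

Lemma clopen_residuation_algebra : residuation_algebra clopen_residual.
Proof.
split=> [f i b|f i b c c'|f i j a c].
- apply: clopen_ext; apply/seteqP; split=> // z _; exact/clopen_residualP.
- apply: clopen_ext; apply/seteqP; split=> z.
    move=> /clopen_residualP Rz.
    by split; apply/clopen_residualP => x xi bx; have [] := Rz x xi bx.
  move=> [/clopen_residualP Rz /clopen_residualP R'z].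
  by apply/clopen_residualP => x xi bx; split; [exact: Rz|exact: R'z].
- apply: iff_trans (clopen_residual_leP _ _ _) _.
  by apply: iff_sym; exact: clopen_residual_leP.
Qed.

(** If f(x) is in c, continuity gives a box around x that f maps into c;
    shrinking its first n - 1 sides to clopen sets yields the witnesses.  In the
    last coordinate the residual only needs to contain the point x_n. *)
Lemma filter_op_point_filter (f : tau) (x : 'I_(arity f) -> X) :
  filter_op clopen_residual (fun i => point_filter (x i)) =
  point_filter (op f x).
Proof.
have [bX op_cont] := opP.
apply/seteqP; split=> c; first by move=> [a [xa /clopen_residualP]]; apply.
move=> cx; have /op_cont/nbhs_ptws_box[V xV Vc] : nbhs (op f x) (clopen_set c).
  by apply: open_nbhs_nbhs; split=> //; exact: (clopen_setP c).1.
have /choice[a aV] : forall j, exists W : clopen_algebra X,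
    clopen_set W (x (lift ord_max j)) /\ W `<=` V (lift ord_max j).
  by move=> j; have [W] := clopen_nbhs bX (xV (lift ord_max j)); exists W.
exists a; split=> [j|]; first exact: (aV j).1.
apply/clopen_residualP => y yx ay; apply: Vc => i.
case: (unliftP ord_max i) => [j ->|->]; first exact: (aV j).2.
by rewrite yx; exact: nbhs_singleton.
Qed.

Lemma clopen_join_preserving : join_preserving_at_primes clopen_residual.
Proof.
have [[cX _ _] _] := opP.
move=> f F /(_ _)/(prime_filter_point cX) => /choice[x Fx].
by rewrite (funext Fx) filter_op_point_filter; exact: point_filter_prime.
Qed.

(** The map x |-> [point_filter x] is injective because X is Hausdorff with a
    clopen basis and onto by [prime_filter_point]; it matches clopen sets W
    with the basic sets [stone_eta W], so it is a homeomorphism. *)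
Lemma clopen_duality :
  topological_algebra_iso op (stone_op clopen_join_preserving).
Proof.
have [bX _] := opP; have [cX hX _] := bX.
pose phi x := StonePoint (@point_filter_prime X x).
have phi_surj y : exists x, phi x = y.
  have [x Fx] := prime_filter_point cX (stone_filter_prime y).
  by exists x; apply: stone_point_ext; rewrite Fx.
have /choice[psi psiK] := phi_surj.
have phi_inj : injective phi.
  move=> x x' phixx'; apply: hX => U V /(clopen_nbhs bX)[W Wx WU] x'V.
  exists x'; split; last exact: nbhs_singleton.
  apply: WU; suff : stone_filter (phi x') W by [].
  by rewrite -phixx'.
exists phi, psi; split=> //.
- by move=> x; apply: phi_inj; exact: psiK.
- move=> x U /nbhs_stone_eta[c cx cU].
  apply: filterS cU _; apply: open_nbhs_nbhs; split=> //.
  exact: (clopen_setP c).1.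
- move=> y U /(clopen_nbhs bX)[W Wy WU].
  have : nbhs y (stone_eta W).
    apply: open_nbhs_nbhs; split; first exact: open_stone_eta.
    by rewrite -(psiK y).
  by apply: filterS => z Wz; apply: WU; move: Wz; rewrite -{1}(psiK z).
- move=> f x; apply: stone_point_ext.
  by rewrite /= -filter_op_point_filter.
Qed.

End Residuals.

Theorem theorem3p17 (tau : signature) :
  (forall (d : Order.disp_t) (B : ctbDistrLatticeType d)
      (R : residuation_ops tau B) (jpR : join_preserving_at_primes R),
    residuation_algebra R -> boolean_topological_algebra (stone_op jpR)) /\
  (forall (X : topologicalType) (op : algebra_ops tau X),
    boolean_topological_algebra op ->
    exists (d : Order.disp_t) (B : ctbDistrLatticeType d)
      (R : residuation_ops tau B) (jpR : join_preserving_at_primes R),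
      residuation_algebra R /\ topological_algebra_iso op (stone_op jpR)).
Proof.
split=> [d B R jpR _|X op opP].
  split; first exact: boolean_stone_space.
  by move=> f; exact: stone_op_continuous.
exists clopen_display, (clopen_algebra X), (clopen_residual opP).
exists (clopen_join_preserving opP).
by split; [exact: clopen_residuation_algebra|exact: clopen_duality].
Qed.
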